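(* Let $\{F_i\}_{i\in\mathcal{V}}$ be the family of graph-directed self-similar sets in $[0,1]^n$ associated with a finite strongly connected directed multigraph $\Gamma=G(\mathcal{V},\mathcal{E})$ and contracting similarities $\{S_e\}_{e\in\mathcal{E}}$ of $\mathbb{R}^n$, each mapping $[0,1]^n$ into itself. Let $F=F_i$ for some $i\in\mathcal{V}$ and let $s=\dim_{\mathrm H}F$. Then, without any separation condition, $\mathcal{H}^s_\infty(F)=\mathcal{H}^s(F)$.
   Context: Hausdorff measure and content: for $F\subseteq\mathbb{R}^n$, $s\ge 0$, $\delta>0$, $\mathcal{H}^s_\delta(F)$ is the infimum of $\sum_k \mathrm{diam}(U_k)^s$ over countable covers $\{U_k\}$ of $F$ by sets of diameter at most $\delta$; $\mathcal{H}^s(F)=\lim_{\delta\to0}\mathcal{H}^s_\delta(F)$; the Hausdorff content $\mathcal{H}^s_\infty(F)$ is the infimum of $\sum_k\mathrm{diam}(U_k)^s$ over all countable covers of $F$ by arbitrary sets. (When $s=0$: $\mathrm{diam}(U)^0=1$ for nonempty $U$ and $\mathrm{diam}(\emptyset)^0=0$.) $\dim_{\mathrm H}$ is Hausdorff dimension. Graph-directed sets: $\Gamma=G(\mathcal{V},\mathcal{E})$ is a finite directed multigraph with vertices $\mathcal{V}=\{1,\dots,N\}$ and a finite multiset of edges $\mathcal{E}$; $\mathcal{E}_{i,j}$ is the multiset of edges from $i$ to $j$. Strongly connected means that for all $i,j\in\mathcal{V}$ (including $i=j$) there is a directed path with at least one edge from $i$ to $j$. Each $S_e$ is a similarity with contraction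 ratio $r_e\in(0,1)$. There is a unique family of nonempty compact sets $\{F_i\}_{i\in\mathcal{V}}$ with $$F_i=\bigcup_{j=1}^N\bigcup_{e\in\mathcal{E}_{i,j}}S_e(F_j)\qquad(i\in\mathcal{V}),$$ and each $F_i$ is called a graph-directed self-similar set. *)

(* Defs.v *)
From HB Require Import structures.
From mathcomp Require Import all_boot all_order all_algebra.
From mathcomp Require Import all_classical all_reals all_analysis.
Set Implicit Arguments.
Unset Strict Implicit.
Unset Printing Implicit Defensive.
Import Order.TTheory GRing.Theory Num.Theory.
Import numFieldNormedType.Exports.

Local Open Scope classical_set_scope.
Local Open Scope ring_scope.
Local Open Scope ereal_scope.

Section Euclidean.
Context {R : realType} {n : nat}.
Implicit Types (x y : 'rV[R]_n) (U F : set 'rV[R]_n) (s delta : R).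

(* The norm provided by the library on row vectors is the sup norm; it induces
   the same topology, but diameters and similarities have to be Euclidean. *)
Definition enorm x : R := Num.sqrt (\sum_(j < n) x ord0 j ^+ 2)%R.

Definition edist x y : R := enorm (x - y)%R.

(* 0 is added to the set of distances so that the empty set has diameter 0
   instead of -oo. *)
Definition diam U : \bar R :=
  ereal_sup (0 |` [set (edist p.1 p.2)%:E | p in U `*` U]).

(* For s = 0 and U nonempty this is 1, as x `^ 0 = 1 for every x : \bar R. *)
Definition diam_pow s U : \bar R :=
  if U == set0 then 0 else (diam U `^ s).

(* Countable covers are sequences of sets; finite ones are padded with set0,
   which contributes 0. *)
Definition hausdorff_delta s delta F : \bar R :=
  ereal_inf [set \sum_(0 <= k <oo) diam_pow s (U k) | U in
    [set U : nat -> set 'rV[R]_n |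
       F `<=` \bigcup_k U k /\ forall k, diam (U k) <= delta%:E]].

Definition hausdorff_measure s F : \bar R :=
  lim (hausdorff_delta s delta F @[delta --> 0%R^'+]).

Definition hausdorff_content s F : \bar R :=
  ereal_inf [set \sum_(0 <= k <oo) diam_pow s (U k) | U in
    [set U : nat -> set 'rV[R]_n | F `<=` \bigcup_k U k]].

Definition hausdorff_dim F : \bar R :=
  ereal_inf [set t%:E | t in
    [set t : R | (0 <= t)%R /\ hausdorff_measure t F = 0]].

Definition similarity (r : R) (f : 'rV[R]_n -> 'rV[R]_n) : Prop :=
  forall x y, edist (f x) (f y) = (r * edist x y)%R.

Definition unit_cube : set 'rV[R]_n :=
  [set x | forall j, (0 <= x ord0 j <= 1)%R].

End Euclidean.

(* A finite directed multigraph on 'I_N is given by a finite type E of edges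
   with maps src, tgt : E -> 'I_N. *)
Section Multigraph.
Context {N : nat} {E : finType} (src tgt : E -> 'I_N).

Definition edges (i j : 'I_N) : set E := [set e | src e = i /\ tgt e = j].

(* The edge sequence e :: p has at least one edge by construction. *)
Definition strongly_connected : Prop :=
  forall i j : 'I_N, exists (e : E) (p : seq E),
    [/\ src e = i, path (fun e1 e2 => tgt e1 == src e2) e p
      & tgt (last e p) = j].

Definition graph_directed_family {R : realType} {n : nat}
    (S : E -> 'rV[R]_n -> 'rV[R]_n) (F : 'I_N -> set 'rV[R]_n) : Prop :=
  forall i : 'I_N,
    [/\ F i !=set0, compact (F i)
      & F i = \bigcup_j \bigcup_(e in edges i j) (S e @` F j)].

End Multigraph.

(* Main.v *)
(* A copy of F = F_i is its image under the composition of the S_e along a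
   closed walk at i. Since dim F = s, pairwise disjoint copies have ratios with
   sum r^s <= 1: otherwise sum r^t >= 1 for some t > s with H^t(F) = 0, whereas
   pulling back a cheap finite cover of F to one of the copies gives a cheap
   cover with fewer sets, an infinite descent. Strong connectedness provides
   arbitrarily small copies near every point of F, so a Vitali selection yields
   countably many disjoint copies, as small as we like, such that F is covered
   by finitely many of them together with enlargements of the others, whose
   contribution is a tail of the convergent series sum r^s. Transporting an
   arbitrary cover of F to these finitely many copies produces a cover by small
   sets of essentially the same cost. *)
Require Import Defs.
From HB Require Import structures.
From mathcomp Require Import all_boot all_order all_algebra finmap.
From mathcomp Require Import all_classical all_reals all_analysis.
From mathcomp Require Import lra ring.
(* all_analysis also defines an edist, which would hide the Euclidean one. *)
Import Defs.
Import Order.TTheory GRing.Theory Num.Theory.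
Import numFieldNormedType.Exports.
Local Open Scope classical_set_scope.
Local Open Scope ring_scope.

Set Implicit Arguments.
Unset Strict Implicit.

(** * Euclidean distance and its compatibility with the sup norm topology *)

Section EuclideanDistance.
Context {R : realType} {n : nat}.
Implicit Types x y z : 'rV[R]_n.

Lemma enorm_ge0 x : 0 <= enorm x.
Proof. exact: sqrtr_ge0. Qed.

Lemma edist_ge0 x y : 0 <= edist x y.
Proof. exact: enorm_ge0. Qed.

Lemma edistxx x : edist x x = 0.
Proof.
rewrite /edist /enorm subrr big1 ?sqrtr0// => j _.
by rewrite mxE expr0n.
Qed.

Lemma edistC x y : edist x y = edist y x.
Proof.
rewrite /edist /enorm; congr Num.sqrt; apply: eq_bigr => j _.
by rewrite !mxE -sqrrN opprB.
Qed.

(* The constant 2 saves proving Minkowski's inequality; constants in the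
   triangle inequality never matter below. *)
Lemma edist_quasi_triangle x y z : edist x z <= 2 * (edist x y + edist y z).
Proof.
have sum_ge0 (v : 'rV[R]_n) : 0 <= \sum_(j < n) v ord0 j ^+ 2.
  by apply: sumr_ge0 => j _; exact: sqr_ge0.
have rhs_ge0 : 0 <= 2 * (edist x y + edist y z).
  by rewrite mulr_ge0// addr_ge0// edist_ge0.
rewrite -(@ler_pXn2r _ 2)// ?nnegrE ?edist_ge0//.
apply: (@le_trans _ _ (2 * (edist x y ^+ 2 + edist y z ^+ 2))); last first.
  have := edist_ge0 x y; have := edist_ge0 y z; nra.
rewrite /edist /enorm !sqr_sqrtr ?sum_ge0// -big_split mulr_sumr/=.
apply: ler_sum => j _; rewrite !mxE.
have := sqr_ge0 ((x ord0 j - y ord0 j) - (y ord0 j - z ord0 j)); nra.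
Qed.

Lemma normr_le_enorm x : `|x| <= enorm x.
Proof.
rewrite /Num.Def.normr/= mx_normrE; apply: bigmax_le => [|[i j] _/=].
  exact: enorm_ge0.
rewrite (ord1 i) -sqrtr_sqr ler_wsqrtr//.
by rewrite (bigD1 j)//= lerDl sumr_ge0// => k _; exact: sqr_ge0.
Qed.

Lemma enorm_continuous : continuous (@enorm R n).
Proof.
have sum_cont : continuous (fun v : 'rV[R]_n => \sum_(j < n) v ord0 j ^+ 2).
  apply: (continuous_big (op := +%R) (P := xpredT)); first exact: add_continuous.
  move=> j _ v; apply: (@continuous_comp _ _ _ (fun v : 'rV[R]_n => v ord0 j)
    (fun a : R => a ^+ 2)).
    exact: coord_continuous.
  exact: exprn_continuous.
by move=> x; apply: continuous_comp; [exact: sum_cont | exact: sqrt_continuous].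
Qed.

Lemma edist_continuous : continuous (fun p : 'rV[R]_n * 'rV[R]_n => edist p.1 p.2).
Proof.
move=> p; apply: (@continuous_comp _ _ _ (fun p : 'rV[R]_n * 'rV[R]_n => p.1 - p.2)).
  exact: sub_continuous.
exact: enorm_continuous.
Qed.

Lemma edist_continuousr x : continuous (edist x).
Proof.
move=> y; apply: (@continuous_comp _ _ _ (fun y => x - y)); last exact: enorm_continuous.
by apply: (@cvgB _ _ _ (nbhs y) _ (cst x) id x y); [exact: cvg_cst | exact: cvg_id].
Qed.

Lemma open_edist_ball x (a : R) : open [set y | edist x y < a].
Proof.
apply: (@open_comp _ _ (edist x) [set b | b < a]); last exact: open_lt.
by move=> y _; exact: edist_continuousr.
Qed.

Lemma similarity_continuous (r : R) (f : 'rV[R]_n -> 'rV[R]_n) :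
  similarity r f -> continuous f.
Proof.
move=> fr x; apply/(@cvgrPdist_lt _ _ _ (nbhs x)) => e e0.
have : (fun y : 'rV[R]_n => r * edist x y) @ x --> r * edist x x.
  apply: (@cvgM _ _ (nbhs x) _ (cst r) (edist x)); [exact: cvg_cst|].
  exact: edist_continuousr.
rewrite edistxx mulr0 => /cvgrPdist_lt/(_ _ e0); apply: filterS => y.
rewrite sub0r normrN -fr; apply: le_lt_trans.
by rewrite (le_trans (normr_le_enorm _))// ler_norm.
Qed.

(** The distance attains its minimum on the compact product of [K] and [L], and a zero minimum would
    give a common point. *)
Lemma edist_separated (K L : set 'rV[R]_n) : compact K -> compact L ->
  K `&` L = set0 ->
  exists2 d : R, 0 < d & forall x y, K x -> L y -> d <= edist x y.
Proof.
move=> cK cL KL0.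
have [[[p q]/= [Kp Lq]]|KL] := pselect (K `*` L !=set0); last first.
  by exists 1 => // x y Kx Ly; exfalso; apply: KL; exists (x, y).
have [] := @compact_EVT_min _ R (fun p => edist p.1 p.2) (K `*` L).
- by exists (p, q).
- exact: compact_setX.
- by apply: continuous_subspaceT => ?; exact: edist_continuous.
move=> [u v] /set_mem[/= Ku Lv] min; exists (edist u v); last first.
  by move=> x y Kx Ly; apply: (min (x, y)); apply/mem_set.
rewrite lt_neqAle edist_ge0 andbT; apply/negP => /eqP uv0.
have : u - v = 0.
  apply/normr0_eq0/le_anti; rewrite normr_ge0 andbT.
  by rewrite (le_trans (normr_le_enorm _))// -/(edist u v) -uv0.
move/subr0_eq => uv; have : (K `&` L) u by split => //; rewrite uv.
by rewrite KL0.
Qed.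

Lemma similarity_comp (r t : R) (f g : 'rV[R]_n -> 'rV[R]_n) :
  similarity r f -> similarity t g -> similarity (r * t) (f \o g).
Proof. by move=> fr gt x y; rewrite /= fr gt mulrA. Qed.

End EuclideanDistance.

(** * Diameters, Hausdorff content and premeasures *)

Section HausdorffContent.
Context {R : realType} {n : nat}.
Implicit Types (x y : 'rV[R]_n) (U F G : set 'rV[R]_n) (s d r : R).
Local Open Scope ereal_scope.

Lemma diam_ge0 U : 0 <= diam U.
Proof. by apply: ereal_sup_ubound; left. Qed.

Lemma edist_le_diam U x y : U x -> U y -> (edist x y)%:E <= diam U.
Proof. by move=> Ux Uy; apply: ereal_sup_ubound; right; exists (x, y). Qed.

Lemma diam_le U (b : \bar R) : 0 <= b ->
  (forall x y, U x -> U y -> (edist x y)%:E <= b) -> diam U <= b.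
Proof.
move=> b0 Ub; apply: ge_ereal_sup => _ [->//|[[x y]/= [Ux Uy] <-]].
exact: Ub.
Qed.

Lemma diam_subset U F : U `<=` F -> diam U <= diam F.
Proof.
move=> UF; apply: diam_le; first exact: diam_ge0.
by move=> x y /UF Fx /UF Fy; exact: edist_le_diam.
Qed.

Lemma diam_similarity r f U : (0 < r)%R -> similarity r f ->
  diam (f @` U) <= r%:E * diam U.
Proof.
move=> r0 fr; apply: diam_le.
  by rewrite mule_ge0 ?lee_fin ?(ltW r0)// diam_ge0.
move=> _ _ [x Ux <-] [y Uy <-].
by rewrite fr EFinM lee_wpmul2l ?lee_fin ?(ltW r0)// edist_le_diam.
Qed.

Lemma le_poweR s (a b : \bar R) : (0 <= s)%R -> 0 <= a -> a <= b ->
  a `^ s <= b `^ s.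
Proof.
move=> s0 a0 ab; apply: gt0_ler_poweR => //; rewrite in_itv/= leey andbT//.
exact: le_trans ab.
Qed.

Lemma diam_pow0 s : diam_pow s (@set0 'rV[R]_n) = 0.
Proof. by rewrite /diam_pow eqxx. Qed.

Lemma diam_pow_ge0 s U : 0 <= diam_pow s U.
Proof. by rewrite /diam_pow; case: ifP => // _; exact: poweR_ge0. Qed.

Lemma diam_powE s U x : U x -> diam_pow s U = diam U `^ s.
Proof.
by move=> Ux; rewrite /diam_pow ifN//; apply/set0P; exists x.
Qed.

Lemma diam_pow_le s U d : (0 <= s)%R -> (0 <= d)%R ->
  (forall x y, U x -> U y -> edist x y <= d)%R -> diam_pow s U <= (d `^ s)%:E.
Proof.
move=> s0 d0 Ud; have [->|/set0P[x Ux]] := eqVneq U set0.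
  by rewrite diam_pow0 lee_fin powR_ge0.
rewrite (diam_powE _ Ux) -poweR_EFin le_poweR ?diam_ge0//.
by apply: diam_le => // ? ? ? ?; rewrite lee_fin Ud.
Qed.

Lemma diam_pow_subset s U F : (0 <= s)%R -> U `<=` F ->
  diam_pow s U <= diam_pow s F.
Proof.
move=> s0 UF; have [->|/set0P[x Ux]] := eqVneq U set0.
  by rewrite diam_pow0 diam_pow_ge0.
rewrite (diam_powE _ Ux) (diam_powE _ (UF _ Ux)) le_poweR ?diam_ge0//.
exact: diam_subset.
Qed.

Lemma diam_pow_similarity s r f U : (0 <= s)%R -> (0 < r)%R ->
  similarity r f -> diam_pow s (f @` U) <= (r `^ s)%:E * diam_pow s U.
Proof.
move=> s0 r0 fr; have [->|/set0P[x Ux]] := eqVneq U set0.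
  by rewrite image_set0 !diam_pow0 mule0.
rewrite (diam_powE _ Ux) (@diam_powE _ _ (f x)); last by exists x.
rewrite -poweR_EFin -poweRM ?diam_ge0 ?lee_fin ?(ltW r0)//.
by rewrite le_poweR ?diam_ge0// diam_similarity.
Qed.

Lemma hausdorff_content_ge0 s F : 0 <= hausdorff_content s F.
Proof.
apply: le_ereal_inf_tmp => _ [U _ <-].
by apply: nneseries_ge0 => k _ _; exact: diam_pow_ge0.
Qed.

Lemma hausdorff_delta_ge0 s d F : 0 <= hausdorff_delta s d F.
Proof.
apply: le_ereal_inf_tmp => _ [U _ <-].
by apply: nneseries_ge0 => k _ _; exact: diam_pow_ge0.
Qed.

Lemma le_content_delta s d F : hausdorff_content s F <= hausdorff_delta s d F.
Proof.
by apply: ereal_inf_le_tmp => _ [U [FU _] <-]; exists U.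
Qed.

Lemma hausdorff_delta_nonincreasing s d d' F : (d <= d')%R ->
  hausdorff_delta s d' F <= hausdorff_delta s d F.
Proof.
move=> dd'; apply: ereal_inf_le_tmp => _ [U [FU Ud] <-]; exists U => //; split=> // k.
by rewrite (le_trans (Ud k))// lee_fin.
Qed.

Lemma le_content_measure s F : hausdorff_content s F <= hausdorff_measure s F.
Proof.
apply: lime_ge; last by near=> d; exact: le_content_delta.
apply: nonincreasing_at_right_is_cvge; near=> d => a b _ _.
exact: hausdorff_delta_nonincreasing.
Unshelve. all: by end_near. Qed.

(** The content bounds every premeasure from below, so under this hypothesis [hausdorff_delta] is
    constant in [d > 0]. The theorem is thereby reduced to an upper bound at each scale. *)
Lemma hausdorff_measure_content s F :
  (forall d, (0 < d)%R -> hausdorff_delta s d F <= hausdorff_content s F) ->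
  hausdorff_measure s F = hausdorff_content s F.
Proof.
move=> dF; apply: lim_near_cst => //; near=> d; apply/le_anti.
rewrite le_content_delta andbT; apply: dF.
by near: d; exact: nbhs_right_gt.
Unshelve. all: by end_near. Qed.

Lemma hausdorff_delta_le_esum (T : countType) s d F (U : T -> set 'rV[R]_n) :
  (0 < d)%R -> F `<=` \bigcup_t U t -> (forall t, diam (U t) <= d%:E) ->
  hausdorff_delta s d F <= \esum_(t in [set: T]) diam_pow s (U t).
Proof.
move=> d0 FU Ud.
pose V k : set 'rV[R]_n := if pickle_inv k is Some t then U t else set0.
have Vpickle t : V (@choice.pickle T t) = U t by rewrite /V pickleK_inv.
apply: (@le_trans _ _ (\sum_(0 <= k <oo) diam_pow s (V k))).
  apply: ereal_inf_lbound; exists V => //; split.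
    by move=> x /FU[t _ Utx]; exists (choice.pickle t) => //; rewrite Vpickle.
  move=> k; rewrite /V; case: pickle_inv => [t|]; first exact: Ud.
  by apply: diam_le; rewrite ?lee_fin ?(ltW d0).
rewrite nneseries_esumT; last by move=> k; exact: diam_pow_ge0.
rewrite (esumID (range (@choice.pickle T))); last by move=> k _; exact: diam_pow_ge0.
rewrite setTI (@reindex_esum _ _ _ setT _ (@choice.pickle T)); last first.
  split => [t _|t u _ _ |k [t _ <-]]; [by exists t| |by exists t].
  exact: pcan_inj (@choice.pickleK T) _ _.
rewrite [X in _ + X]esum1 ?adde0 => [|k [_ nk]].
  by apply: le_esum => t _; rewrite Vpickle.
rewrite /V; case kt : pickle_inv => [t|]; last exact: diam_pow0.
by exfalso; apply: nk; exists t => //; have := @pickle_invK T k; rewrite kt.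
Qed.

Lemma hausdorff_deltaU s d F G : (0 < d)%R ->
  hausdorff_delta s d (F `|` G) <= hausdorff_delta s d F + hausdorff_delta s d G.
Proof.
move=> d0.
have [->|Ffin] := eqVneq (hausdorff_delta s d F) +oo.
  by rewrite addye ?leey// gt_eqF// (lt_le_trans _ (hausdorff_delta_ge0 _ _ _))// ltNy0.
have [->|Gfin] := eqVneq (hausdorff_delta s d G) +oo.
  by rewrite addey ?leey// gt_eqF// (lt_le_trans _ (hausdorff_delta_ge0 _ _ _))// ltNy0.
have fin (H : set 'rV[R]_n) : hausdorff_delta s d H != +oo ->
    hausdorff_delta s d H \is a fin_num.
  by move=> ?; rewrite ge0_fin_numE ?hausdorff_delta_ge0// ltey.
apply/lee_addgt0Pr => e e0; have e20 : (0 < e / 2)%R by rewrite divr_gt0.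
have [_ [U [FU Ud] <-] Ue] := lb_ereal_inf_adherent e20 (fin _ Ffin).
have [_ [V [GV Vd] <-] Ve] := lb_ereal_inf_adherent e20 (fin _ Gfin).
(* Two nearly optimal covers are merged into one countable family. *)
pose W (p : bool * nat) := if p.1 then U p.2 else V p.2.
have sumW : \esum_(t in [set: bool * nat]) diam_pow s (W t) =
    \sum_(0 <= k <oo) diam_pow s (U k) + \sum_(0 <= k <oo) diam_pow s (V k).
  rewrite -setXTT -(@esum_esum _ _ _ setT (fun=> setT)
    (fun b k => diam_pow s (W (b, k)))); last first.
    by move=> *; exact: diam_pow_ge0.
  rewrite !nneseries_esumT; try by move=> *; exact: diam_pow_ge0.
  rewrite (_ : [set: bool] = [set true; false]); last first.
    by apply/seteqP; split => // -[] _; [left|right].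
  rewrite esum_fset; [|exact: finite_set2|]; last first.
    by move=> *; apply: esum_ge0 => *; exact: diam_pow_ge0.
  by rewrite fsbigU0/= ?fsbig_set1// => b [/= -> /=].
apply: (@le_trans _ _ (\esum_(t in [set: bool * nat]) diam_pow s (W t))).
  apply: hausdorff_delta_le_esum => // [x [/FU|/GV] [k _ xk]|].
  - by exists (true, k).
  - by exists (false, k).
  - by case=> -[] k; [exact: Ud | exact: Vd].
rewrite sumW (splitr e) EFinD addeACA; apply: leeD; exact: ltW.
Qed.

Lemma hausdorff_delta_bigsetU (I : eqType) s d (J : seq I) (G : I -> set 'rV[R]_n) :
  (0 < d)%R ->
  hausdorff_delta s d (\big[setU/set0]_(i <- J) G i) <=
  \sum_(i <- J) hausdorff_delta s d (G i).
Proof.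
move=> d0; elim: J => [|i J IH].
  rewrite !big_nil; apply: ge_ereal_inf; exists 0 => //; exists (fun=> set0).
    by split=> // k; apply: diam_le; rewrite ?lee_fin ?(ltW d0).
  by rewrite eseries0// => k _ _; exact: diam_pow0.
rewrite !big_cons; apply: (le_trans (hausdorff_deltaU _ _ _ d0)).
exact: leeD2l.
Qed.

Lemma hausdorff_delta_subset s d F G : F `<=` G ->
  hausdorff_delta s d F <= hausdorff_delta s d G.
Proof.
move=> FG; apply: ereal_inf_le_tmp => _ [U [GU Ud] <-]; exists U => //; split=> //.
exact: subset_trans GU.
Qed.

(* Covers may be restricted to F itself, so that small copies of F inherit
   fine covers from arbitrary covers of F. *)
Lemma hausdorff_delta_similarity s d r f F : (0 <= s)%R -> (0 < r)%R ->
  similarity r f -> r%:E * diam F <= d%:E ->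
  hausdorff_delta s d (f @` F) <= (r `^ s)%:E * hausdorff_content s F.
Proof.
move=> s0 r0 fr rF.
rewrite -lee_pdivrMl ?powR_gt0//.
apply: le_ereal_inf_tmp => _ [U FU <-]; rewrite lee_pdivrMl ?powR_gt0//.
rewrite -nneseriesZl; last by move=> *; exact: diam_pow_ge0.
apply: ge_ereal_inf; eexists.
  exists (fun k => f @` (U k `&` F)); last by [].
  split=> [_ [x Fx <-]|k].
    by have [k _ Ukx] := FU _ Fx; exists k => //; exists x.
  apply: le_trans rF; apply: (le_trans (diam_similarity _ r0 fr)).
  by rewrite lee_wpmul2l ?lee_fin ?(ltW r0)// diam_subset.
apply: lee_nneseries => [k _ _|k _]; first exact: diam_pow_ge0.
apply: (le_trans (diam_pow_similarity _ s0 r0 fr)).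
by rewrite lee_wpmul2l ?lee_fin ?powR_ge0// diam_pow_subset.
Qed.

End HausdorffContent.

(** * Uniform positive thresholds and real powers *)

Section Reals.
Context {R : realType}.

(** The minimum of finitely many positive thresholds serves for all, as [P t] passes to smaller
    ones. *)
Lemma exists_pos_uniform (T : eqType) (J : seq T)
    (P : T -> R -> Prop) :
  (forall t d d', d' <= d -> P t d -> P t d') ->
  (forall t, t \in J -> exists2 d, 0 < d & P t d) ->
  exists2 d, 0 < d & forall t, t \in J -> P t d.
Proof.
move=> Pmono; elim: J => [_|t J IH JP]; first by exists 1.
have [u|d d0 Pd] := IH; first by move=> uJ; apply: JP; rewrite inE uJ orbT.
have [e e0 Pe] := JP t (mem_head _ _).
exists (Num.min d e) => [|u]; first by rewrite lt_min d0.
rewrite inE => /predU1P[->|uJ].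
  by apply: Pmono Pe; rewrite ge_min lexx orbT.
by apply: Pmono (Pd _ uJ); rewrite ge_min lexx.
Qed.

Lemma ltr_powR_inv (a b t : R) : 0 <= t -> 0 <= b ->
  a `^ t < b `^ t -> a < b.
Proof.
move=> t0 b0; apply: contraTT; rewrite -!leNgt => ba.
by apply: ge0_ler_powR => //; rewrite nnegrE// (le_trans b0).
Qed.

End Reals.

(** * Cost of finite covers of a set containing separated copies of itself *)

Section LowerBound.
Context {R : realType} {n : nat}.
Implicit Types (F : set 'rV[R]_n).

(* If the sum of a^t were below d^t, every V j would meet at most one copy of
   F; for one of these copies the pulled back cover by the sets meeting it
   would again be too cheap, but strictly shorter. *)
Lemma finite_cover_lower_bound (I : eqType) (A : seq I)
    (f : I -> 'rV[R]_n -> 'rV[R]_n) (r : I -> R) F (d t : R) :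
  F !=set0 -> uniq A -> (1 < size A)%N -> 0 < d -> 0 < t ->
  (forall i, i \in A -> 0 < r i) ->
  (forall i, i \in A -> similarity (r i) (f i)) ->
  (forall i, i \in A -> f i @` F `<=` F) ->
  (forall i j, i \in A -> j \in A -> i != j ->
    forall x y, F x -> F y -> d <= edist (f i x) (f j y)) ->
  1 <= \sum_(i <- A) r i `^ t ->
  forall (J : seq nat) (V : nat -> set 'rV[R]_n) (a : nat -> R),
    (forall j, j \in J -> 0 <= a j) ->
    (forall j, j \in J -> forall x y, V j x -> V j y -> edist x y <= a j) ->
    (forall x, F x -> exists2 j, j \in J & V j x) ->
  d `^ t <= \sum_(j <- J) a j `^ t.
Proof.
move=> [x0 Fx0] uA sA d0 t0 r0 fr fF sep sumr J V a; have [m] := ubnP (size J).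
(* [V] and [a] stay general, as the induction hypothesis is applied to pulled back sets with bounds
   [a j / r i]. *)
elim: m J V a => // m IH J V a; rewrite ltnS => sJ a0 Va FJ.
rewrite leNgt; apply/negP => small.
have a_lt j : j \in J -> a j < d.
  move=> jJ; rewrite ltNge; apply/negP => da.
  move: small; rewrite ltNge => /negP; apply.
  apply: (@le_trans _ _ (a j `^ t)); last first.
    by rewrite (big_rem j)//= lerDl sumr_ge0// => *; exact: powR_ge0.
  by rewrite ge0_ler_powR// ?nnegrE ?(ltW t0) ?(ltW d0) ?a0.
pose meets i j := `[< exists2 x, F x & V j (f i x) >].
have meets_inj i i' j : i \in A -> i' \in A -> j \in J ->
    meets i j -> meets i' j -> i = i'.
  move=> iA i'A jJ /asboolP[x Fx Vx] /asboolP[y Fy Vy].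
  apply/eqP; apply: contraT => ii'.
  have := le_trans (sep _ _ iA i'A ii' _ _ Fx Fy) (Va _ jJ _ _ Vx Vy).
  by rewrite leNgt a_lt.
have copy_bound i : i \in A ->
    r i `^ t * d `^ t <= \sum_(j <- J | meets i j) a j `^ t.
  move=> iA; have ri := r0 _ iA.
  have shorter : (size [seq j <- J | meets i j] < m)%N.
    apply: leq_trans sJ; rewrite size_filter ltn_neqAle count_size andbT.
    rewrite -all_count; apply/negP => /allP allJ.
    (* If every set met copy [i], a set containing a point of another copy [i'] would meet both. *)
    have [i' i'A ii'] : exists2 i', i' \in A & i' != i.
      move: uA sA iA; case: (A) => [|i1 [|i2 A']]//= /andP[]; rewrite inE.
      move=> /norP[i12 _] _ _ _; have [<-|i1i] := eqVneq i1 i.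
        by exists i2; rewrite ?inE ?eqxx ?orbT// eq_sym.
      by exists i1; rewrite ?inE ?eqxx.
    have [j jJ Vj] := FJ _ (fF _ i'A _ (imageP _ Fx0)).
    move/eqP: ii'; apply; apply: (meets_inj _ _ j) => //; last exact: allJ.
    by apply/asboolP; exists x0.
  have := IH _ (fun j => f i @^-1` V j) (fun j => a j / r i) shorter.
  rewrite big_filter => bound.
  have -> : \sum_(j <- J | meets i j) a j `^ t =
      r i `^ t * \sum_(j <- J | meets i j) (a j / r i) `^ t.
    rewrite mulr_sumr big_seq_cond [RHS]big_seq_cond.
    apply: eq_bigr => j /andP[jJ _].
    by rewrite -powRM ?divr_ge0 ?a0 ?(ltW ri)// mulrC divfK ?gt_eqF.
  rewrite ler_wpM2l ?powR_ge0//; apply: bound => [j|j|x Fx].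
  - by rewrite mem_filter => /andP[_ jJ]; rewrite divr_ge0 ?a0 ?ltW.
  - rewrite mem_filter => /andP[_ jJ] x y Vx Vy.
    by rewrite ler_pdivlMr// mulrC -fr// (Va _ jJ).
  - have [j jJ Vj] := FJ _ (fF _ iA _ (imageP _ Fx)).
    by exists j => //; rewrite mem_filter jJ andbT; apply/asboolP; exists x.
have sum_copies : d `^ t <= \sum_(i <- A) \sum_(j <- J | meets i j) a j `^ t.
  apply: (@le_trans _ _ (\sum_(i <- A) r i `^ t * d `^ t)).
    by rewrite -mulr_suml ler_peMl ?powR_ge0.
  by rewrite big_seq [leRHS]big_seq; exact: ler_sum.
move: small; rewrite ltNge => /negP; apply; apply: (le_trans sum_copies).
(* After the exchange each [a j] is counted at most once, since [V j] meets at most one copy. *)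
rewrite (exchange_big_dep predT)//= big_seq [leRHS]big_seq.
apply: ler_sum => j jJ; rewrite big_const_seq iter_addr_0.
suff : (count (meets^~ j) A <= 1)%N.
  by case: count => [|[|]]// _; rewrite ?mulr0n ?mulr1n ?powR_ge0.
rewrite -size_filter; set B := seq.filter _ _.
have : uniq B by exact: filter_uniq.
have BP i : i \in B -> meets i j /\ i \in A by rewrite mem_filter => /andP.
case: B BP => [|i1 [|i2 B]]//= BP /andP[]; rewrite inE => /norP[/eqP i12 _] _.
have [m1 A1] := BP i1 (mem_head _ _).
have [|m2 A2] := BP i2; first by rewrite !inE eqxx orbT.
by exfalso; apply: i12; exact: (meets_inj _ _ j).
Qed.

End LowerBound.

(** * Positivity of the content and ratios of disjoint copies *)

Section Dimension.
Context {R : realType} {n : nat}.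
Implicit Types (F : set 'rV[R]_n).

(** Compactness turns a cheap countable cover into a finite one once its sets are enlarged to open
    balls, at the price of a constant factor and an arbitrarily small excess. *)
Lemma content_gt0 F (t c : R) : 0 < t -> 0 < c -> compact F ->
  (forall (J : seq nat) (V : nat -> set 'rV[R]_n) (a : nat -> R),
    (forall j, j \in J -> 0 <= a j) ->
    (forall j, j \in J -> forall x y, V j x -> V j y -> edist x y <= a j) ->
    (forall x, F x -> exists2 j, j \in J & V j x) ->
    c <= \sum_(j <- J) a j `^ t) ->
  (0 < hausdorff_content t F)%E.
Proof.
move=> t0 c0 cF bound; rewrite ltNge; apply/negP => content0.
(* The cover will cost less than [e] and the enlargements add at most [e]; even after the factor 4
   to the power [t] the total stays below [c]. *)
pose e := c / (4 `^ t * 2).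
have four0 : 0 < (4 : R) `^ t by rewrite powR_gt0.
have e0 : 0 < e by rewrite divr_gt0// mulr_gt0.
have [_ [U FU <-] Ue] : exists2 y, [set \sum_(0 <= k <oo) diam_pow t (U k) | U in
    [set U : nat -> set 'rV[R]_n | F `<=` \bigcup_k U k]]%E y & (y < e%:E)%E.
  by apply: ereal_inf_lt; rewrite (le_lt_trans content0)// lte_fin.
pose b k := fine (diam_pow t (U k)).
have b_ge0 k : 0 <= b k by rewrite fine_ge0// diam_pow_ge0.
have bE k : diam_pow t (U k) = (b k)%:E.
  rewrite fineK// ge0_fin_numE ?diam_pow_ge0//; apply: le_lt_trans (ltry e).
  apply: le_trans (ltW Ue).
  rewrite (le_trans _ (nneseries_lim_ge k.+1 _))//; last by move=> *; exact: diam_pow_ge0.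
  rewrite big_nat_recr//= leeDr// sume_ge0// => *; exact: diam_pow_ge0.
(* The excess makes the radius [a k] exceed the diameter strictly, even a zero one, so that the open
   ball contains [U k]. *)
pose w k := b k + e / (2 ^ k.+1)%:R.
have w_gt k : b k < w k by rewrite ltrDl divr_gt0// ltr0n expn_gt0.
pose a k := w k `^ t^-1.
have at_w k : a k `^ t = w k.
  by rewrite -powRrM mulVf ?gt_eqF// powRr1// (le_trans (b_ge0 k))// ltW.
(* An empty [U k] gets the default centre 0, and its ball costs only the excess. *)
pose x k := xget (0 : 'rV[R]_n) (U k).
pose V k := [set y | edist (x k) y < a k].
have UV k : U k `<=` V k.
  move=> y Uy; have Ux : U k (x k) by exact: (@xgetPex _ _ (U k) (ex_intro _ y Uy)).
  apply: (ltr_powR_inv (ltW t0)); first exact: powR_ge0.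
  rewrite at_w; apply: le_lt_trans (w_gt k); rewrite -lee_fin -bE.
  rewrite (diam_powE _ Uy) -poweR_EFin le_poweR ?(ltW t0)// ?lee_fin ?edist_ge0//.
  exact: edist_le_diam.
move: cF; rewrite compact_cover => /(_ nat setT V).
case=> [k _|y /FU[k _ Uy]|D _ FD].
- exact: open_edist_ball.
- by exists k => //; exact: UV.
(* The 4 combines two radii with the constant 2 of [edist_quasi_triangle]. *)
have := bound D V (fun k => 4 * a k); rewrite leNgt => /(_ _ _ _)/negP; apply.
- by move=> k _; rewrite mulr_ge0// powR_ge0.
- move=> k _ y z Vy Vz; have := edist_quasi_triangle y (x k) z.
  move: Vy Vz; rewrite /V/= (edistC (x k) y) => yk kz; lra.
- by move=> y /FD[k Dk Vy]; exists k.
have -> : \sum_(j <- D) (4 * a j) `^ t = 4 `^ t * \sum_(j <- D) w j.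
  by rewrite mulr_sumr; apply: eq_bigr => k _; rewrite powRM ?powR_ge0// at_w.
rewrite mulrC -ltr_pdivlMr// -lte_fin -sumEFin.
have -> : c / 4 `^ t = e + e by rewrite /e; field; rewrite gt_eqF.
apply: (@le_lt_trans _ _ (\sum_(0 <= k <oo) (w k)%:E)%E).
  apply: lee_sum_fset_lim => k _; rewrite lee_fin.
  by rewrite (le_trans (b_ge0 k))// ltW.
apply: (@le_lt_trans _ _ (\sum_(0 <= k <oo) diam_pow t (U k) + e%:E)%E); last first.
  by rewrite EFinD lteD2rE.
apply: le_trans (epsilon_trick xpredT _ (ltW e0)); last first.
  by move=> k; exact: diam_pow_ge0.
apply: lee_nneseries => k _ => [_|].
  by rewrite lee_fin (le_trans (b_ge0 k))// ltW.
by rewrite bE.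
Qed.

(** Every cover has a nonempty member, which alone costs 1. *)
Lemma hausdorff_content0_gt0 F : F !=set0 -> (0 < hausdorff_content 0 F)%E.
Proof.
move=> [x Fx]; apply: (@lt_le_trans _ _ 1%E) => //.
apply: le_ereal_inf_tmp => _ [U FU <-]; have [k _ Ux] := FU _ Fx.
rewrite (le_trans _ (nneseries_lim_ge k.+1 _))//; last by move=> *; exact: diam_pow_ge0.
rewrite big_nat_recr//= (diam_powE _ Ux) poweRe0 leeDr// sume_ge0// => *.
exact: diam_pow_ge0.
Qed.

Lemma disjoint_copies_sum_le1 (I : eqType) (A : seq I)
    (f : I -> 'rV[R]_n -> 'rV[R]_n) (r : I -> R) F (s : R) :
  compact F -> F !=set0 -> hausdorff_dim F = s%:E -> uniq A ->
  (forall i, i \in A -> 0 < r i <= 1) ->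
  (forall i, i \in A -> similarity (r i) (f i)) ->
  (forall i, i \in A -> f i @` F `<=` F) ->
  (forall i j, i \in A -> j \in A -> i != j ->
    f i @` F `&` f j @` F = set0) ->
  \sum_(i <- A) r i `^ s <= 1.
Proof.
move=> cF F0 dimF uA r01 fr fF disj; rewrite leNgt; apply/negP => sumr.
have r0 i : i \in A -> 0 < r i by move=> /r01/andP[].
have s0 : 0 <= s.
  rewrite -lee_fin -dimF; apply: le_ereal_inf_tmp => _ [t [t0 _] <-].
  by rewrite lee_fin.
(* A single term is at most 1, so a sum above 1 needs two copies. *)
have sA : (1 < size A)%N.
  move: sumr r01; case: (A) => [|i [|//]]; first by rewrite big_nil ltr10.
  rewrite big_seq1 => sumr /(_ i (mem_head _ _)) ri.
  by move: sumr; rewrite ltNge -[leRHS](powRr0 (r i)) ger_powR.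
have [m0 m0_gt0 m0r] : exists2 m, 0 < m & forall i, i \in A -> m <= r i.
  apply: (exists_pos_uniform (P := fun i m => m <= r i)) => [i d d' d'd|i iA].
    exact: le_trans.
  by exists (r i) => //; exact: r0.
(* The cap 1/2 keeps [ln m] negative. *)
pose m := Num.min m0 (1 / 2).
have m_gt0 : 0 < m by rewrite lt_min m0_gt0; lra.
have m_lt1 : m < 1 by rewrite gt_min; apply/orP; right; lra.
have mr i : i \in A -> m <= r i by move=> iA; rewrite ge_min m0r.
pose S := \sum_(i <- A) r i `^ s.
have lnm : ln m < 0 by rewrite ln_lt0// m_gt0.
(* Chosen so that [m] to the power [e] is [1 / S]: raising the exponent by at most [e] divides the
   sum by at most [S], leaving it at least 1. *)
pose e := ln S / - ln m.
have e0 : 0 < e by rewrite divr_gt0 ?ln_gt0// oppr_gt0.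
have me : m `^ e = S^-1.
  rewrite /powR gt_eqF// /e invrN mulrN mulNr divfK ?lt_eqF//.
  by rewrite expRN lnK// posrE (lt_trans ltr01).
have [_ [t [t0 Ht] <-] ts] : exists2 y,
    [set t%:E | t in [set t : R | (0 <= t)%R /\ hausdorff_measure t F = 0%E]] y &
    (y < (s + e)%:E)%E.
  by apply: ereal_inf_lt; rewrite -/(hausdorff_dim F) dimF lte_fin ltrDl.
have content0 : (hausdorff_content t F <= 0)%E.
  by rewrite -Ht; exact: le_content_measure.
(* Exponent 0 is treated apart, as the lower bound asks for [0 < t]. *)
have [t_eq0|tN0] := eqVneq t 0.
  by move: content0; rewrite t_eq0 leNgt hausdorff_content0_gt0.
have {tN0} t_gt0 : 0 < t by rewrite lt_neqAle eq_sym tN0.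
have [d d0 sep] : exists2 d, 0 < d & forall p, p \in allpairs pair A A ->
    p.1 != p.2 -> forall x y, F x -> F y -> d <= edist (f p.1 x) (f p.2 y).
  apply: (exists_pos_uniform (P := fun p d => p.1 != p.2 ->
      forall x y, F x -> F y -> d <= edist (f p.1 x) (f p.2 y))).
    by move=> p d d' d'd H ij x y Fx Fy; rewrite (le_trans d'd)// H.
  move=> _ /allpairsP[[i j]/= [iA jA ->]]/=.
  have [ij|ij] := eqVneq i j; first by exists 1.
  have cf k : k \in A -> compact (f k @` F).
    move=> kA; apply: continuous_compact => //; apply: continuous_subspaceT.
    exact: similarity_continuous (fr _ kA).
  have [d d0 dP] := edist_separated (cf _ iA) (cf _ jA) (disj _ _ iA jA ij).
  by exists d => // _ x y Fx Fy; apply: dP; exact: imageP.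
move: content0; rewrite leNgt => /negP; apply.
apply: (@content_gt0 _ _ (d `^ t)) => //; first by rewrite powR_gt0.
apply: (finite_cover_lower_bound F0 uA sA d0 t_gt0 r0 fr fF) => [i j iA jA ij|].
  by apply: (sep (i, j)) => //; apply: allpairs_f.
apply: (@le_trans _ _ (\sum_(i <- A) r i `^ s * m `^ e)).
  by rewrite -mulr_suml me -/S mulfV// gt_eqF// (lt_trans ltr01).
rewrite big_seq [leRHS]big_seq; apply: ler_sum => i iA.
apply: (@le_trans _ _ (r i `^ s * r i `^ e)).
  rewrite ler_wpM2l ?powR_ge0// ge0_ler_powR ?nnegrE ?(ltW e0) ?(ltW m_gt0) ?mr//.
  exact: ltW (r0 _ iA).
rewrite -powRD; last by rewrite (gt_eqF (r0 _ iA)) implybT.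
by rewrite ger_powR ?r01// ltW// -lte_fin.
Qed.

End Dimension.

(** * Vitali selection in a family of sets of bounded size *)

Section VitaliSelection.
Context {R : realType} {I T : Type}.

(* By Zorn, take a maximal disjoint W such that every set meeting a member of W
   meets one of at least half its size; an i in A meeting no member of W, with
   r i larger than half the supremum, could be added to W. *)
Lemma vitali_selection (K : I -> set T) (r : I -> R) (A : set I) (M : R) :
  (forall i, A i -> K i !=set0) -> (forall i, A i -> 0 < r i <= M) ->
  exists W : set I, [/\ W `<=` A,
    forall i j, W i -> W j -> i <> j -> K i `&` K j = set0 &
    forall i, A i ->
      exists j, [/\ W j, K i `&` K j !=set0 & r i <= 2 * r j]].
Proof.
move=> K0 rM.
(* Restricting the last clause to indices that already meet a member of [W] makes it stable under
   unions of chains. *)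
pose P (W : set I) := [/\ W `<=` A,
  forall i j, W i -> W j -> i <> j -> K i `&` K j = set0 &
  forall i j, A i -> W j -> K i `&` K j !=set0 ->
    exists j', [/\ W j', K i `&` K j' !=set0 & r i <= 2 * r j']].
have [C CP chain|W [[WA Wdisj Wlarge] Wmax]] := @Zorn_bigcup _ P.
  split=> [i [W /CP[WA _ _]]|i j [W CW Wi] [W' CW' W'j]|i j Ai [W CW Wj] ij].
  - exact: WA.
  - have [WW'|W'W] := chain _ _ CW CW'.
      by have [_ + _] := CP _ CW'; apply => //; exact: WW'.
    by have [_ + _] := CP _ CW; apply => //; exact: W'W.
  - have [_ _ /(_ _ _ Ai Wj ij)[j' [Wj' ij' rr]]] := CP _ CW.
    by exists j'; split => //; exists W.
exists W; split=> // i Ai.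
have [[j Wj ij]|nmeet] := pselect (exists2 j, W j & K i `&` K j !=set0).
  exact: Wlarge ij.
pose B := [set i | A i /\ forall j, W j -> K i `&` K j = set0].
have Bi : B i.
  split=> // j Wj; apply/eqP; apply: contra_notT nmeet => /set0P ij.
  by exists j.
have supB : has_sup (r @` B).
  split; first by exists (r i); exists i.
  by exists M => _ [k [/rM/andP[_ kM] _] <-].
have rB k : B k -> r k <= sup (r @` B).
  by move=> Bk; apply: sup_upper_bound => //; exists k.
have sup_gt0 : 0 < sup (r @` B).
  by apply: lt_le_trans (rB _ Bi); have /andP[] := rM _ Ai.
have [|_ [k [Ak kW] <-] rk] := @sup_adherent _ (r @` B) (sup (r @` B) / 2) _ supB.
  by rewrite divr_gt0.
have Wk : ~ W k.
  by move=> /kW; rewrite setIid => Kk0; have := K0 _ Ak; rewrite Kk0 => -[].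
exfalso; apply: (Wmax (W `|` [set k])).
split; first by move=> j Wj; left.
  by move=> /(_ k) WkW; apply: Wk; apply: WkW; right.
split=> [j [/WA//|->//]|j l [Wj|->] [Wl|->] jl|j l Aj [Wl|->] jl].
- exact: Wdisj.
- by rewrite setIC; exact: kW.
- exact: kW.
- by [].
- by have [j' [Wj' jj' rr]] := Wlarge _ _ Aj Wl jl; exists j'; split=> //; left.
have [[m Wm jm]|nj] := pselect (exists2 m, W m & K j `&` K m !=set0).
  by have [j' [Wj' jj' rr]] := Wlarge _ _ Aj Wm jm; exists j'; split=> //; left.
exists k; split=> //; first by right.
(* A [j] meeting no old member competes in [B], where [r k] exceeds half the supremum. *)
have /rB : B j.
  split=> // m Wm; apply/eqP; apply: contra_notT nj => /set0P jm.
  by exists m.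
by move: rk; lra.
Qed.

End VitaliSelection.

(** * Content and measure of a set with small copies near each point *)

Section DenseCopies.
Context {R : realType} {n : nat}.

(** Bounded partial sums make the total finite, and a finite subset whose sum is within [e] of it
    leaves a tail of at most [e]. *)
Lemma esum_tail (T : choiceType) (W : set T) (a : T -> R) (M e : R) :
  (forall i, 0 <= a i) -> 0 < e ->
  (forall X : {fset T}, [set` X] `<=` W -> \sum_(i <- X) a i <= M) ->
  exists X : {fset T}, [set` X] `<=` W /\
    (\esum_(i in W `\` [set` X]) (a i)%:E <= e%:E)%E.
Proof.
move=> a0 e0 aM.
have aE0 i : (0 <= (a i)%:E)%E by rewrite lee_fin.
have sumE (X : set T) : finite_set X -> (\sum_(i \in X) (a i)%:E =
    (\sum_(i <- finmap.enum_fset (fset_set X)) a i)%:E)%E.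
  by move=> finX; rewrite fsbig_finite//= sumEFin.
have esumM : (\esum_(i in W) (a i)%:E <= M%:E)%E.
  apply: ge_ereal_sup => _ [X [finX XW] <-]; rewrite sumE// lee_fin; apply: aM.
  by rewrite fset_setK.
have esumfin : \esum_(i in W) (a i)%:E \is a fin_num.
  by rewrite ge0_fin_numE ?esum_ge0// (le_lt_trans esumM)// ltry.
have [_ [X [finX XW] <-] Xe] := ub_ereal_sup_adherent e0 esumfin.
exists (fset_set X); rewrite fset_setK//; split=> //.
move: (Xe : (\esum_(i in W) (a i)%:E - e%:E < \sum_(i \in X) (a i)%:E)%E) esumfin.
rewrite (esumID X)// (_ : W `&` X = X); last exact/setIidPr.
rewrite esum_fset// sumE//; set S := \sum_(i <- _) _.
rewrite -setDE; case: (\esum_(i in W `\` X) (a i)%:E)%E => [b||]//.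
  by rewrite -EFinN -!EFinD lte_fin lee_fin => Sb _; lra.
Qed.

(** Separates the covering argument from the graph, which enters only through the last hypothesis:
    small copies near every point, at distances comparable to their ratios. *)
Theorem content_eq_measure_of_dense_copies (I : countType)
    (f : I -> 'rV[R]_n -> 'rV[R]_n) (r : I -> R) (F : set 'rV[R]_n)
    (s C D : R) :
  compact F -> F !=set0 -> hausdorff_dim F = s%:E ->
  (forall i, 0 < r i <= 1) -> (forall i, similarity (r i) (f i)) ->
  (forall i, f i @` F `<=` F) ->
  0 < C -> 0 < D -> (forall x y, F x -> F y -> edist x y <= D) ->
  (forall x e, F x -> 0 < e ->
    exists2 i, r i < e & forall y, F y -> edist x (f i y) <= C * r i) ->
  hausdorff_content s F = hausdorff_measure s F.
Proof.
move=> cF F0 dimF r01 fr fF C0 D0 FD dense.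
have r0 i : 0 < r i by have /andP[] := r01 i.
have s0 : 0 <= s.
  rewrite -lee_fin -dimF; apply: le_ereal_inf_tmp => _ [t [t0 _] <-].
  by rewrite lee_fin.
apply/esym/hausdorff_measure_content => d d0.
(* If a copy near [x] has ratio at most [2 * r j] and meets copy [j], then [x] is within
   [2 * (2 * C + D) * r j] of all of copy [j]; [C2] bounds the diameter of the resulting
   enlargement. *)
pose C1 := 4 * C + 2 * D; pose C2 := 4 * C1.
have C10 : 0 < C1 by rewrite /C1; lra.
have C20 : 0 < C2 by rewrite /C2; lra.
(* Ratios up to [d1] give copies and enlargements of diameter at most [d]. *)
pose d1 := Num.min (d / C2) (d / D).
have d10 : 0 < d1 by rewrite lt_min !divr_gt0.
have rd i : r i <= d1 -> r i * C2 <= d /\ r i * D <= d.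
  by rewrite le_min !ler_pdivlMr// => /andP.
have [W [WA Wdisj Wlarge]] := @vitali_selection R I _ (fun i => f i @` F) r
  [set i | r i <= d1] 1 (fun i _ => image_nonempty (f i) F0) (fun i _ => r01 i).
have cK i : compact (f i @` F).
  apply: continuous_compact => //; apply: continuous_subspaceT.
  exact: similarity_continuous (fr i).
have sumW (X : {fset I}) : [set` X] `<=` W ->
    \sum_(i <- X) r i `^ s <= 1.
  move=> XW; apply: (disjoint_copies_sum_le1 (f := f) cF F0 dimF) => //.
    exact: fset_uniq.
  by move=> i j iX jX /eqP ij; apply: Wdisj => //; exact: XW.
apply/lee_addgt0Pr => e e0.
(* With [C2] inside the series, its tail directly bounds the cost of the enlargements. *)
have sumC2W (X : {fset I}) : [set` X] `<=` W ->
    \sum_(i <- X) (C2 * r i) `^ s <= C2 `^ s.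
  move=> XW; under eq_bigr do rewrite powRM ?(ltW C20) ?(ltW (r0 _))//.
  by rewrite -mulr_sumr ler_piMr ?powR_ge0 ?sumW.
have [X [XW tail]] := esum_tail (fun i => powR_ge0 _ _) e0 sumC2W.
pose K := \big[setU/set0]_(i <- X) (f i @` F).
pose B i := [set x | forall y, F y -> edist x (f i y) <= C1 * r i].
(* Indices outside the tail get the empty set, so that all of [I] indexes the cover. *)
pose U i := if i \in W `\` [set` X] then B i else set0.
have diamB i x y : B i x -> B i y -> edist x y <= C2 * r i.
  have [z Fz] := F0 => /(_ _ Fz) xz /(_ _ Fz) yz.
  have := edist_quasi_triangle x (f i z) y; rewrite (edistC (f i z)) /C2; nra.
have cover : F `<=` K `|` \bigcup_i U i.
  move=> x Fx; have [Kx|nKx] := pselect (K x); [by left|right].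
  have [d2 d20 xK] : exists2 d2, 0 < d2 & forall i, i \in X ->
      forall y, F y -> d2 <= edist x (f i y).
    apply: (exists_pos_uniform (P := fun i d2 => forall y, F y -> d2 <= edist x (f i y))).
      by move=> i d2 d2' d2d2' xd2 y Fy; rewrite (le_trans d2d2')// xd2.
    move=> i iX; have [|d2 d20 d2P] := edist_separated (@compact_set1 _ x) (cK i).
      apply/seteqP; split=> // z [-> xi]; apply: nKx.
      by rewrite /K -bigcup_seq; exists i.
    by exists d2 => // y Fy; apply: d2P => //; exists y.
  (* A ratio below [d2 / C] keeps copy [i] closer to [x] than any copy from [X], so the selected
     copy it meets lies in the tail. *)
  have [|i ri xi] := dense x (Num.min d1 (d2 / C)) Fx.
    by rewrite lt_min d10 divr_gt0.
  move: ri; rewrite lt_min ltr_pdivlMr// => /andP[rid1 rid2].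
  have [j [Wj [_ [[y Fy <-] [y' Fy' yy']]] rij]] := Wlarge i (ltW rid1).
  exists j => //; rewrite /U ifT; last first.
    apply/mem_set; split=> // jX; have := xK j jX y' Fy'; rewrite yy' leNgt.
    by move=> /negP; apply; apply: le_lt_trans rid2; rewrite mulrC xi.
  move=> z Fz; have := edist_quasi_triangle x (f j y') (f j z).
  have := xi _ Fy; rewrite -yy' fr; have := FD _ _ Fy' Fz.
  have := r0 j; rewrite /C1; nra.
apply: (le_trans (hausdorff_delta_subset s d cover)).
(* The copies in [X] cost at most the content, by [sumW], and the enlargements at most [e]. *)
apply: (le_trans (hausdorff_deltaU _ _ _ d0)); apply: leeD.
  apply: (le_trans (hausdorff_delta_bigsetU _ _ _ d0)).
  apply: (@le_trans _ _ (\sum_(i <- X) (r i `^ s)%:E * hausdorff_content s F)%E).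
    rewrite big_seq [leRHS]big_seq; apply: lee_sum => i iX.
    apply: hausdorff_delta_similarity => //.
    have [_ rD] := rd _ (WA _ (XW _ iX)).
    apply: le_trans (_ : (r i * D)%:E <= _)%E; last by rewrite lee_fin.
    rewrite EFinM lee_wpmul2l ?lee_fin ?(ltW (r0 i))//.
    by apply: diam_le; [rewrite lee_fin ltW|move=> *; rewrite lee_fin FD].
  rewrite -ge0_sume_distrl; last by move=> i _; rewrite lee_fin powR_ge0.
  by rewrite sumEFin -[leRHS]mul1e lee_wpmul2r ?hausdorff_content_ge0// lee_fin sumW.
have diamU i : (diam (U i) <= d%:E)%E.
  rewrite /U; case: ifPn => [/set_mem[Wi _]|_]; last first.
    by apply: diam_le; rewrite ?lee_fin ?(ltW d0).
  have [rC _] := rd _ (WA _ Wi).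
  apply: diam_le => [|x y Bx By]; rewrite lee_fin ?(ltW d0)//.
  by apply: le_trans rC; rewrite mulrC diamB.
apply: (@le_trans _ _ (\esum_(i in [set: I]) diam_pow s (U i))).
  exact: hausdorff_delta_le_esum.
apply: le_trans tail; rewrite [leRHS]esum_mkcond; apply: le_esum => i _.
rewrite /U; case: ifPn => _; last by rewrite diam_pow0.
apply: diam_pow_le => //; first by rewrite mulr_ge0 ?(ltW C20) ?(ltW (r0 i)).
exact: diamB.
Qed.

End DenseCopies.

(** * Words of edges, their maps and ratios *)

Section GraphWords.
Context {R : realType} {n N : nat} {E : finType} (src tgt : E -> 'I_N).
Context (r : E -> R) (S : E -> 'rV[R]_n -> 'rV[R]_n).
Implicit Types (w u v : seq E) (i j k : 'I_N).

(** The empty word is allowed, so the identity counts as a copy, of ratio 1. *)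
Fixpoint walk i w j : bool :=
  if w is e :: w' then (src e == i) && walk (tgt e) w' j else i == j.

(** The first edge acts last, so a walk from [i] to [j] carries [F j] into [F i]. *)
Fixpoint word_map w : 'rV[R]_n -> 'rV[R]_n :=
  if w is e :: w' then S e \o word_map w' else id.

Definition word_ratio w : R := \prod_(e <- w) r e.

Lemma walk_cat i u j v k : walk i u j -> walk j v k -> walk i (u ++ v) k.
Proof.
elim: u i => [|e u IH] i /=; first by move=> /eqP->.
by move=> /andP[-> uj] vk; exact: IH.
Qed.

Lemma word_map_cat u v x : word_map (u ++ v) x = word_map u (word_map v x).
Proof. by elim: u => //= e u ->. Qed.

Lemma word_ratio_cat u v : word_ratio (u ++ v) = word_ratio u * word_ratio v.
Proof. exact: big_cat. Qed.

Lemma strongly_connected_walk : strongly_connected src tgt ->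
  forall i j, exists w, walk i w j.
Proof.
move=> conn i j; have [e [p [<- ep <-]]] := conn i j.
exists (e :: p); rewrite /= eqxx /=.
elim: p e ep => [|e' p IH] e /=; first by rewrite eqxx.
by move=> /andP[/eqP <- /IH ->]; rewrite eqxx.
Qed.

Context (hr : forall e, 0 < r e < 1).

Lemma word_ratio01 w : 0 < word_ratio w <= 1.
Proof.
rewrite /word_ratio prodr_gt0 => [/=|e _]; last by have /andP[] := hr e.
by apply: prodr_ile1 => e _; have /andP[/ltW -> /ltW ->] := hr e.
Qed.

(** Finitely many edges have ratios bounded by a common [q < 1], whose powers tend to 0. *)
Lemma long_words_small (e : R) : 0 < e ->
  exists m, forall w, size w = m -> word_ratio w < e.
Proof.
move=> e0.
have [d d0 rd] : exists2 d, 0 < d & forall a, a \in enum E -> r a <= 1 - d.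
  apply: (exists_pos_uniform (P := fun a d => r a <= 1 - d)) => [a d d' d'd|a _].
    by move=> rad; rewrite (le_trans rad)// lerB.
  exists (1 - r a); last by rewrite subKr.
  by have /andP[_] := hr a; rewrite subr_gt0.
(* Truncation keeps the base nonnegative even if no edge bounds [d] from above. *)
pose q := Num.max 0 (1 - d).
have q0 : 0 <= q by rewrite le_max lexx.
have q1 : `|q| < 1 by rewrite ger0_norm// gt_max ltr01/=; lra.
have /cvgrPdist_lt/(_ e e0)[m _ /(_ m (leqnn m))] := cvg_expr q1.
rewrite sub0r normrN ger0_norm ?exprn_ge0// => qm.
exists m => w wm; apply: le_lt_trans qm; rewrite -wm /word_ratio.
elim: w {wm} => [|a w IH]; first by rewrite big_nil expr0.
rewrite big_cons exprS ler_pM ?prodr_ge0// => [|a' _|].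
- by have /andP[/ltW] := hr a.
- by have /andP[/ltW] := hr a'.
- by rewrite le_max rd ?orbT// mem_enum.
Qed.

Context (hS : forall e, similarity (r e) (S e)).

Lemma word_similarity w : similarity (word_ratio w) (word_map w).
Proof.
elim: w => [|e w IH] x y; first by rewrite /word_ratio big_nil mul1r.
by rewrite /word_ratio big_cons; exact: (similarity_comp (hS e) IH).
Qed.

Context (F : 'I_N -> set 'rV[R]_n) (hF : graph_directed_family src tgt S F).

Lemma walk_image i w j : walk i w j -> word_map w @` F j `<=` F i.
Proof.
elim: w i => [|e w IH] i /=; first by move=> /eqP-> _ [x Fx <-].
move=> /andP[/eqP ei /IH wF] _ [x Fx <-].
have [_ _ ->] := hF i; exists (tgt e) => //; exists e => //.
by exists (word_map w x) => //; apply: wF; exists x.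
Qed.

(** Unfolding the defining equation [m] times locates each point in a piece that is small for large
    [m]. *)
Lemma word_address m i x : F i x ->
  exists w j y, [/\ walk i w j, size w = m, F j y & x = word_map w y].
Proof.
elim: m i x => [|m IH] i x Fx; first by exists [::], i, x; rewrite /= eqxx.
have [_ _ Fi] := hF i; move: Fx; rewrite Fi => -[j _ [e [ei ej] [y Fy <-]]].
have [w [k [z [wk wm Fz ->]]]] := IH _ _ Fy.
by exists (e :: w), k, z; rewrite /= ei ej wk wm eqxx.
Qed.

End GraphWords.

(** * Graph-directed sets in the unit cube *)

Lemma edist_unit_cube {R : realType} {n : nat} (x y : 'rV[R]_n) :
  unit_cube x -> unit_cube y -> edist x y <= Num.sqrt n%:R.
Proof.
move=> cx cy; rewrite /edist /enorm ler_wsqrtr//.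
rewrite -[leRHS]mulr1 mulr_natl -[n in leRHS]card_ord -sumr_const.
apply: ler_sum => j _; rewrite !mxE.
have := cx j; have := cy j; nra.
Qed.

Unset Implicit Arguments.
Set Strict Implicit.

Theorem corollary2p4 (R : realType) (n N : nat) (E : finType)
    (src tgt : E -> 'I_N)
    (r : E -> R) (S : E -> 'rV[R]_n -> 'rV[R]_n)
    (F : 'I_N -> set 'rV[R]_n)
    (hconn : strongly_connected src tgt)
    (hr : forall e, 0 < r e < 1)
    (hS : forall e, similarity (r e) (S e))
    (hcube : forall e, S e @` unit_cube `<=` unit_cube)
    (hF : graph_directed_family src tgt S F)
    (hFcube : forall i, F i `<=` unit_cube)
    (i : 'I_N) (s : R)
    (hs : hausdorff_dim (F i) = s%:E) :
  hausdorff_content s (F i) = hausdorff_measure s (F i).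
Proof.
have [F0 cF _] := hF i.
have ratio01 := word_ratio01 hr.
have ratio_gt0 w : 0 < word_ratio r w by have /andP[] := ratio01 w.
have simw := word_similarity hS.
(* The added 1 keeps [D] positive for [n = 0]. *)
pose D : R := Num.sqrt n%:R + 1.
have D0 : 0 < D by rewrite ltr_wpDl ?sqrtr_ge0.
have FD j x y : F j x -> F j y -> edist x y <= D.
  move=> /hFcube cx /hFcube cy.
  by rewrite (le_trans (edist_unit_cube cx cy))// lerDl.
(* The return word [q j] closes any walk from [i] to [j]; finitely many vertices give a uniform
   lower bound [c] on the return ratios. *)
have /choice[q qi] : forall j, exists w, walk src tgt j w i.
  by move=> j; exact: strongly_connected_walk.
have [c c0 cq] : exists2 c, 0 < c &
    forall j, j \in enum 'I_N -> c <= word_ratio r (q j).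
  apply: (exists_pos_uniform (P := fun j c => c <= word_ratio r (q j))).
    by move=> j c c' c'c cr; exact: le_trans cr.
  by move=> j _; exists (word_ratio r (q j)).
pose I := {w : seq E | walk src tgt i w i}.
(* [D / c] works as [C]: the point and its nearby copy lie in the image of [F j] under [u], where
   distances are at most [D * word_ratio r u], and closing [u] by [q j] costs at most a factor [c]
   in the ratio. *)
apply: (@content_eq_measure_of_dense_copies _ _ I (fun w => word_map S (val w))
  (fun w => word_ratio r (val w)) _ _ (D / c) D) => //.
- by move=> [w wi]; exact: (walk_image hF wi).
- by rewrite divr_gt0.
- exact: FD.
move=> x e Fx e0; have [m small] := long_words_small hr e0.
have [u [j [y [uj um Fy ->]]]] := word_address hF m Fx.
exists (Sub (u ++ q j) (walk_cat uj (qi j)) : I) => [|z Fz] /=.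
  rewrite word_ratio_cat (le_lt_trans _ (small _ um))// ler_piMr ?(ltW (ratio_gt0 _))//.
  by have /andP[] := ratio01 (q j).
rewrite word_map_cat word_ratio_cat simw.
rewrite [leRHS](_ : _ = word_ratio r u * (D * (word_ratio r (q j) / c))); last by ring.
rewrite ler_wpM2l ?(ltW (ratio_gt0 _))//.
apply: (@le_trans _ _ D).
  by apply: (FD j) => //; apply: (walk_image hF (qi j)); exists z.
by rewrite ler_peMr ?(ltW D0)// ler_pdivlMr// mul1r cq// mem_enum.
Qed.
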